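(* Let $F$ be a field, let $n\ge 2$, and let $P$ be a standard parabolic subgroup of $\mathrm{GL}_n(F)$ with Weyl group $W$. Let $O_1,\dots,O_r$ be the orbits of $W$ acting on $\{1,\dots,n\}$. Let $C$ and $D$ be alternating $n\times n$ matrices over $F$ and let $Y$ and $Z$ be $(1,-1)$-matrices that are $B$-congruent to $C$ and $D$, respectively. Let $\sigma'$ and $\tau'$ be the reduced permutations associated to $Y$ and $Z$, respectively. Then the following conditions are equivalent: (a) $\sigma'$ is $W$-conjugate to $\tau'$ and $Y\{i,i\}=Z\{i,i\}$ for all $1\leq i\leq r$. (b) $C$ and $D$ are $P$-congruent. (c) $C$ and $D$ are $P$-equivalent.
   Context: $X'$ denotes the transpose of $X$. A matrix is alternating if it is skew-symmetric with zero diagonal. $B$ is the group of all invertible upper triangular $n\times n$ matrices over $F$. For a subgroup $H$ of $\mathrm{GL}_n(F)$, $n\times n$ matrices $X,Y$ over $F$ are $H$-equivalent if there exist $h,k\in H$ with $Y=h'Xk$, and $H$-congruent if there exists $h\in H$ with $h'Xh=Y$. A standard parabolic subgroup $P$ of $\mathrm{GL}_n(F)$ is a subgroup containing $B$. Such a $P$ is generated by $B$ and a set $J$ of transpositions of the form $(i,i+1)$, $1\le i<n$, viewed as permutation matrices (equivalently, $P$ is the group of invertible block upper triangular matrices for some fixed decomposition of $n$ into diagonal block sizes). The Weyl group $W$ of $P$ is the subgroup of $S_n$ generated by $J$. Two permutations $\alpha,\beta\in S_n$ are $W$-conjugate if $w\alpha w^{-1}=\beta$ for some $w\in W$. A sub-permutation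 is a matrix having at most one non-zero entry in every row and every column. A $(1,-1)$-matrix is a sub-permutation alternating matrix whose only non-zero entries above the main diagonal are equal to $1$. If $Y$ is an $n\times n$ sub-permutation matrix, a $Y$-couple is a pair $(f,\sigma)$ with $\sigma\in S_n$ and $f:\{1,\dots,n\}\to F$ such that $Ye_i=f(i)e_{\sigma(i)}$ for $1\le i\le n$, where $e_1,\dots,e_n$ is the canonical basis of $F^n$; $S(f)$ is the set of indices where $f$ does not vanish. For $1\le i,j\le r$, $Y\{i,j\}$ is the number of indices $k$ such that $k\in S(f)$, $k\in O_i$ and $\sigma(k)\in O_j$. Reduced permutation: if $Y$ is alternating, the $Y$-couple $(f,\sigma)$ may be chosen with $\sigma^2=1$. The reduced permutation $\sigma'$ associated to $Y$ is the permutation obtained from $\sigma$ by eliminating all transpositions $(i,j)$ in the cycle decomposition of $\sigma$ such that either $i,j$ are in the same $W$-orbit or $f(i)=0$ (and hence $f(j)=0$). Thus $\sigma'$ is the product of the disjoint transpositions $(i,j)$ such that $Y_{ij}\neq 0$ and $i,j$ lie in different $W$-orbits; it does not depend on the choice of $(f,\sigma)$. *)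

(* Defs.v *)
From mathcomp Require Import all_boot all_order all_algebra all_fingroup.

Set Implicit Arguments.
Unset Strict Implicit.
Unset Printing Implicit Defensive.

Import GroupScope GRing.Theory.
Local Open Scope ring_scope.

Section Matrices.
Variables (F : fieldType) (n : nat).
Implicit Types (H S P : 'M[F]_n -> Prop) (X Y g h k : 'M[F]_n).

Definition alternating X : Prop := X^T = - X /\ forall i, X i i = 0.

(* F is arbitrary, so GL_n(F) need not be a finGroupType: its subgroups are
   predicates on square matrices. *)
Definition GL_subgroup H : Prop :=
  [/\ forall g, H g -> g \in unitmx,
      H 1%:M,
      forall g h, H g -> H h -> H (g *m h)
    & forall g, H g -> H (invmx g)].

(* is_trig_mx means lower triangular, hence the transpose. *)
Definition borel g : Prop := g \in unitmx /\ is_trig_mx g^T.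

Definition equivalent_under H X Y : Prop :=
  exists h k, [/\ H h, H k & Y = h^T *m X *m k].

Definition congruent_under H X Y : Prop :=
  exists h, H h /\ h^T *m X *m h = Y.

Definition standard_parabolic P : Prop :=
  GL_subgroup P /\ forall g, borel g -> P g.

Definition generated_by S g : Prop :=
  forall H, GL_subgroup H -> (forall x, S x -> H x) -> H g.

Definition adjacent_transposition (s : 'S_n) : Prop :=
  exists i j : 'I_n, j = i.+1 :> nat /\ s = tperm i j.

Definition weyl_group_of P (W : {group 'S_n}) : Prop :=
  exists J : {set 'S_n},
    [/\ forall s, s \in J -> adjacent_transposition s,
        forall g, P g <->
          generated_by
            (fun x => borel x \/ exists2 s, s \in J & x = perm_mx s) g
      & W :=: <<J>>].

Definition sub_permutation Y : Prop :=
  (forall i j1 j2, Y i j1 != 0 -> Y i j2 != 0 -> j1 = j2) /\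
  (forall i1 i2 j, Y i1 j != 0 -> Y i2 j != 0 -> i1 = i2).

Definition one_minus_one_matrix Y : Prop :=
  [/\ sub_permutation Y, alternating Y
    & forall i j : 'I_n, (i < j)%N -> Y i j != 0 -> Y i j = 1].

Definition couple Y (f : 'I_n -> F) (sigma : 'S_n) : Prop :=
  forall i, Y *m (delta_mx i 0 : 'cV[F]_n) = f i *: delta_mx (sigma i) 0.

(* Y{A, A'} for a Y-couple (f, sigma). *)
Definition couple_count (f : 'I_n -> F) (sigma : 'S_n) (A A' : {set 'I_n})
    : nat :=
  #|[set k | [&& f k != 0, k \in A & sigma k \in A']]|.

(* For sigma an involution: the product of the transpositions (i, sigma i) of
   its cycle decomposition, each listed once through i < sigma i, that remain
   after elimination. They are disjoint, so the order is irrelevant. *)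
Definition reduced_perm (W : {group 'S_n}) (f : 'I_n -> F) (sigma : 'S_n)
    : 'S_n :=
  (\prod_(i : 'I_n | [&& (i < sigma i)%N, f i != 0
                       & sigma i \notin orbit 'P W i])
     tperm i (sigma i))%g.

(* The couples used to form reduced permutations always exist. *)
Lemma involutive_couple_exists Y :
  sub_permutation Y -> alternating Y ->
  exists f sigma, couple Y f sigma /\ (sigma * sigma = 1)%g.
Proof.
move=> [rowY colY] [altY _].
have symY i j : (Y i j != 0) = (Y j i != 0).
  by have := congr1 (fun M : 'M_n => M j i) altY; rewrite !mxE => ->;
    rewrite oppr_eq0.
pose s i := if [pick j | Y j i != 0] is Some j then j else i.
have sE i j : Y j i != 0 -> s i = j.
  rewrite /s; case: pickP => [k Yki Yji|/(_ j) ->//].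
  exact: colY Yki Yji.
have sK : involutive s.
  move=> i; rewrite {2}/s; case: pickP => [j Yji|Y0].
    by apply: sE; rewrite symY.
  by rewrite /s; case: pickP => // j; rewrite Y0.
exists (fun i => Y (s i) i), (perm (inv_inj sK)); split; last first.
  by apply/permP=> i; rewrite permM !permE sK.
move=> i; rewrite -colE; apply/matrixP=> k l; rewrite !mxE permE ord1 eqxx andbT.
case: eqP => [->|ne]; first by rewrite mulr1.
by rewrite mulr0; apply/eqP; apply: contraPT isT => /sE /esym /ne.
Qed.

End Matrices.

(* permutations compose from left to right, so alpha ^ w = w^-1 * alpha * w is
   the map w o alpha o w^-1 *)
Definition conjugate_under n (W : {group 'S_n}) (alpha beta : 'S_n) : Prop :=
  exists2 w, w \in W & (alpha ^ w)%g = beta.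

(* Main.v *)
(** Both directions pass through the numbers Y{i,j} for all pairs of orbits.
    For i <> j, Y{i,j} is read off the reduced permutation. Conversely, if
    Y{i,j} = Z{i,j} for all i and j, the two partial matchings of {1,...,n}
    carried by Y and Z are conjugate under an orbit-preserving permutation w.
    Such a w lies in W, conjugates the reduced permutations, and carries Y to Z
    up to a diagonal matrix. Finally, P-equivalence preserves the ranks of the
    upper left blocks cut out by the flag that P stabilizes; for a
    sub-permutation these ranks count nonzero entries, and differences of them
    give the Y{i,j}. *)
Require Import Defs.
From mathcomp Require Import all_boot all_order all_algebra all_fingroup.

Set Implicit Arguments.
Unset Strict Implicit.
Unset Printing Implicit Defensive.

Import GroupScope GRing.Theory.
Local Open Scope ring_scope.

(** * Conjugating coloured partial matchings *)

Definition color_count (T : finType) (I : eqType) (c : T -> I) (S : {set T})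
    (s : T -> T) (a b : I) : nat :=
  #|[set k in S | (c k == a) && (c (s k) == b)]|.

(** The conditions concern only the points of [S]; elsewhere [s] is arbitrary. This lets one pair be
    deleted from the matching at a time while [s] itself stays unchanged. *)
Definition fixfree_involution_on (T : finType) (S : {set T}) (s : T -> T) :=
  {in S, forall k, [/\ s k \in S, s (s k) = k & s k != k]}.

Lemma fixfree_involution_onD (T : finType) (S : {set T}) (s : T -> T) k :
  k \in S -> fixfree_involution_on S s ->
  fixfree_involution_on (S :\: [set k; s k]) s.
Proof.
move=> kS h j; rewrite !inE negb_or => /andP[/andP[jk jsk] jS].
have [sS ssj sj] := h j jS; have [_ ssk _] := h k kS.
split=> //; rewrite sS andbT negb_or; apply/andP; split.
  by apply: contra_neq jsk => <-.
by apply: contra_neq jk => e; rewrite -ssj e ssk.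
Qed.

Lemma color_countD (T : finType) (I : eqType) (c : T -> I) (S : {set T})
    (s : T -> T) k a b :
  k \in S -> fixfree_involution_on S s ->
  color_count c S s a b =
  ((c k == a) && (c (s k) == b) + (c (s k) == a) && (c k == b)
    + color_count c (S :\: [set k; s k]) s a b)%N.
Proof.
move=> kS h; have [sS ssk sk] := h k kS.
rewrite /color_count (cardsD1 k) (cardsD1 (s k)) !inE kS sS ssk sk /= addnA.
by congr (_ + _ + _)%N; apply: eq_card => j; rewrite !inE negb_or -!andbA;
  case: (j == k) (j == s k) => -[].
Qed.

(** Induction on the size of [S]. Equal counts supply, for a pair [k], [s k] in [S], a pair in [S']
    with the same ordered colours. Deleting both pairs changes the two counts by the same amount, so
    the rest is matched by induction. *)
Lemma matching_conjugate (T : finType) (I : eqType) (c : T -> I)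
    (S S' : {set T}) (s s' : T -> T) :
  fixfree_involution_on S s -> fixfree_involution_on S' s' ->
  (forall a b, color_count c S s a b = color_count c S' s' a b) ->
  exists w : {perm T}, [/\ forall k, c (w k) = c k,
    forall k, (w k \in S') = (k \in S) & {in S, forall k, w (s k) = s' (w k)}].
Proof.
have [m] := ubnP #|S|; elim: m S S' => // m IHm S S' leSm hS hS' eqc.
have [S0|[k kS]] := set_0Vmem S.
  exists 1%g; split=> k; rewrite ?perm1 // S0 !inE //.
  (* A point of [S'] would be counted at its own pair of colours, where the count for the empty [S]
     is zero. *)
  apply: contraTF isT => kS'; have := eqc (c k) (c (s' k)).
  rewrite {1}/color_count S0 (_ : [set _ in _ | _] = set0); last first.
    by apply/setP=> j; rewrite !inE.
  rewrite cards0 => /esym/eqP; rewrite cards_eq0 => /eqP/setP/(_ k).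
  by rewrite !inE kS' !eqxx.
have [k' k'S' [ck csk]]: exists2 k', k' \in S' & c k' = c k /\ c (s' k') = c (s k).
  have : (0 < color_count c S' s' (c k) (c (s k)))%N.
    by rewrite -eqc; apply/card_gt0P; exists k; rewrite inE kS !eqxx.
  case/card_gt0P=> k'; rewrite inE => /and3P[k'S' /eqP e1 /eqP e2].
  by exists k'.
have [sS ssk sk] := hS k kS; have [s'S' ssk' sk'] := hS' k' k'S'.
have [||||w [cw Sw sw]] := IHm (S :\: [set k; s k]) (S' :\: [set k'; s' k']).
- rewrite -ltnS; apply: leq_trans leSm; rewrite ltnS; apply: proper_card.
  by apply/properP; split; [exact: subsetDl | exists k; rewrite // !inE eqxx].
- exact: fixfree_involution_onD.
- exact: fixfree_involution_onD.
- move=> a b; have := eqc a b.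
  by rewrite (color_countD _ _ _ kS hS) (color_countD _ _ _ k'S' hS') ck csk => /addnI.
(* None of w k, w (s k), k', s' k' lies in the smaller matching on S', and the
   colours agree, so w can be corrected on k and s k by transpositions. *)
pose w1 := (w * tperm (w k) k')%g; pose w2 := (w1 * tperm (w1 (s k)) (s' k'))%g.
have w1k : w1 k = k' by rewrite permM tpermL.
have w1sk : w1 (s k) != k' by rewrite -w1k (inj_eq perm_inj).
have w2k : w2 k = k' by rewrite permM w1k tpermD // eq_sym.
have w2sk : w2 (s k) = s' k' by rewrite permM tpermL.
have ct (x y z : T) : c x = c y -> c (tperm x y z) = c z.
  by move=> e; case: tpermP => // ->.
have cw1 j : c (w1 j) = c j by rewrite permM ct ?cw.
have cw2 j : c (w2 j) = c j by rewrite permM ct ?cw1.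
have tS (x y z : T) (A : {set T}) :
    x \notin A -> y \notin A -> (tperm x y z \in A) = (z \in A).
  by move=> xA yA; case: tpermP => // ->; rewrite (negPf xA) (negPf yA).
have Sw1 j : (w1 j \in S' :\: [set k'; s' k']) = (j \in S :\: [set k; s k]).
  by rewrite permM tS ?Sw // !inE eqxx.
have Sw2 j : (w2 j \in S' :\: [set k'; s' k']) = (j \in S :\: [set k; s k]).
  by rewrite permM tS ?Sw1 // !inE eqxx ?orbT.
have w2w j : j \in S :\: [set k; s k] -> w2 j = w j.
  move=> jS; have := jS; rewrite -Sw !inE negb_or => /andP[/andP[n1 n2] _].
  have /andP[m1 m2] : (j != k) && (j != s k).
    by move: jS; rewrite !inE negb_or => /andP[].
  have w1j : w1 j = w j by rewrite permM tpermD // 1?eq_sym // (inj_eq perm_inj).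
  rewrite permM w1j tpermD // 1?eq_sym //.
  by rewrite -w1j (inj_eq perm_inj).
exists w2; split=> // j.
  have [->|jk] := eqVneq j k; first by rewrite w2k kS k'S'.
  have [->|jsk] := eqVneq j (s k); first by rewrite w2sk sS s'S'.
  have -> : (j \in S) = (j \in S :\: [set k; s k]).
    by rewrite !inE negb_or jk jsk.
  by rewrite -Sw2 !inE negb_or -{1}w2k -{1}w2sk !(inj_eq perm_inj) jk jsk.
move=> jS; have [->|jk] := eqVneq j k; first by rewrite w2k w2sk.
have [->|jsk] := eqVneq j (s k); first by rewrite w2sk !ssk ssk' w2k.
have jS2 : j \in S :\: [set k; s k] by rewrite !inE negb_or jk jsk.
have [sjS2 _ _] := fixfree_involution_onD kS hS jS2.
by rewrite !w2w // sw.
Qed.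

(** A group generated by transpositions contains every transposition of two points of one orbit,
    hence the full symmetric group on each orbit. *)
Lemma perm_stabilizing_orbits (T : finType) (W : {group {perm T}}) :
  (exists J : {set {perm T}},
    (forall s, s \in J -> exists x y, s = tperm x y) /\ W :=: <<J>>%g) ->
  forall w : {perm T}, (forall x, orbit 'P W (w x) = orbit 'P W x) -> w \in W.
Proof.
case=> J [Jt WJ].
have tW x y : y \in orbit 'P W x -> tperm x y \in W.
  case/orbitP=> s sW <- {y}; rewrite /= /aperm.
  have : s \in <<J>>%g by rewrite -WJ.
  (* Induction on the length of a word in [J] that carries [x] to the second point. *)
  move=> /gen_prodgP[m [e eJ ->]] {s sW}; elim: m x e eJ => [|m IHm] x e eJ.
    by rewrite big_ord0 perm1 tperm1 group1.
  rewrite big_ord_recr permM /=; set u : {perm T} := (\prod_i _)%g.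
  set z := u x.
  have zW : tperm x z \in W by apply: IHm.
  clearbody z.
  have [a [b eab]] := Jt _ (eJ ord_max).
  have eW : tperm a b \in W by rewrite WJ -eab mem_gen // eJ.
  rewrite eab; have [->|nz] := eqVneq (tperm a b z) z; first exact: zW.
  have [->|nx] := eqVneq x (tperm a b z); first by rewrite tperm1 group1.
  have ez : tperm z (tperm a b z) \in W.
    case: tpermP nz => [->|->|]; rewrite ?eqxx // => _.
    by rewrite tpermC.
  have [->|nxz] := eqVneq x z; first exact: ez.
  (* The last letter swaps [z] with a new point; conjugating the transposition of [x] and [z] by
     that letter gives the transposition of [x] and the new point. *)
  suff -> : tperm x (tperm a b z) = (tperm x z ^ tperm z (tperm a b z))%g.
    exact: groupJ.
  by rewrite tpermJ tpermL [tperm z _ x]tpermD // eq_sym.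
(* Induction on the number of moved points: following [w] by the transposition of [x] and [w x]
   fixes [x] and every point already fixed by [w]. *)
move=> w; have [m] := ubnP #|[set x | w x != x]|; elim: m w => // m IHm w lem wo.
have [e0|[x]] := set_0Vmem [set x | w x != x].
  suff -> : w = 1%g by exact: group1.
  apply/permP=> x; rewrite perm1; apply/eqP; apply: contraTT isT => nx.
  by have := in_set0 x; rewrite -e0 inE nx.
rewrite inE => wx; pose t := tperm x (w x).
have tWx : t \in W by apply: tW; rewrite -orbit_eq_mem wo.
rewrite -(groupMr w tWx); apply: IHm.
  rewrite -ltnS; apply: leq_trans lem; rewrite ltnS.
  apply: proper_card; apply/properP; split.
    apply/subsetP=> y; rewrite !inE permM /t; apply: contra_neq => wy.
    rewrite wy tpermD //; first by apply: contra_neq wx => ->.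
    by apply: contra_neq wx => e; apply: (@perm_inj _ w); rewrite e wy.
  by exists x; rewrite !inE // permM tpermR eqxx.
move=> y; rewrite permM -[RHS]wo; apply/orbit_eqP.
by apply/orbitP; exists t.
Qed.

(** The hypothesis on [Q] selects at most one point of each pair [i], [s i], so the nontrivial
    factors are disjoint and at most one of them moves [k]. *)
Lemma prod_tperm_involution (T : finType) (s : T -> T) (Q : pred T) (k : T) :
  involutive s -> (forall i, Q i -> ~~ Q (s i)) ->
  (\prod_(i | Q i) tperm i (s i))%g k = if Q k || Q (s k) then s k else k.
Proof.
move=> sK Qs; have := index_enum_uniq T.
(* Membership in the index list is made explicit so that the claim can be proved by induction over
   an arbitrary duplicate-free list. *)
have -> : Q k || Q (s k) =
    (k \in index_enum T) && Q k || (s k \in index_enum T) && Q (s k).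
  by rewrite !mem_index_enum.
elim: (index_enum T) k => [|a r IHr] k /=; first by rewrite big_nil perm1.
case/andP=> ar ur; rewrite big_cons !in_cons.
have [Qa|nQa] := ifPn; last first.
  have nQ x : ((x == a) || (x \in r)) && Q x = (x \in r) && Q x.
    by case: eqP => [->|//]; rewrite (negPf nQa) !andbF.
  by rewrite IHr // !nQ.
rewrite permM; case: tpermP => [->|->|/eqP ka /eqP ksa].
- by rewrite IHr // sK (negPf ar) (negPf (Qs _ Qa)) andbF eqxx Qa.
- by rewrite IHr // sK (negPf ar) (negPf (Qs _ Qa)) andbF eqxx Qa orbT.
rewrite IHr // (negPf ka) (_ : (s k == a) = false) //.
by apply: contra_neqF ksa => /eqP <-; rewrite sK.
Qed.
(** * Ranks of blocks of sub-permutations *)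

Lemma rank_diag_mx (F : fieldType) n (d : 'rV[F]_n) :
  \rank (diag_mx d) = #|[set k | d 0 k != 0]|.
Proof.
have rank_le (e : 'rV[F]_n) : (\rank (diag_mx e) <= #|[set k | (e 0 k != 0)%R]|)%N.
  rewrite diag_mx_sum_delta -sum1_card [X in (_ <= X)%N]big_mkcond /=.
  apply: (big_ind2 (fun (M : 'M_n) m => (\rank M <= m)%N)).
  - by rewrite mxrank0.
  - by move=> M1 m1 M2 m2 h1 h2; apply: leq_trans (mxrank_add _ _) (leq_add h1 h2).
  move=> i _; rewrite inE; have [->|_] /= := eqVneq; first by rewrite scale0r mxrank0.
  by rewrite (leq_trans (mxrank_scale _ _)) ?mxrank_delta.
(* The complementary diagonal matrix forces equality, since ranks are
   subadditive and the sum is invertible. *)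
pose e : 'rV[F]_n := \row_k (d 0 k == 0)%:R.
have u : diag_mx (d + e) \in unitmx.
  rewrite unitmxE unitfE det_diag; apply/prodf_neq0 => i _; rewrite !mxE.
  by have [->|] := eqVneq (d 0 i) 0; rewrite ?add0r ?oner_eq0 // addr0.
apply/eqP; rewrite eqn_leq rank_le /= -(leq_add2r (\rank (diag_mx e))).
apply: (@leq_trans n); last first.
  by rewrite -[X in (X <= _)%N](mxrank_unit u) linearD mxrank_add.
rewrite -[X in (_ <= X)%N]card_ord -(cardsC [set k | d 0 k != 0]) leq_add2l.
apply: leq_trans (rank_le e) (subset_leq_card _); apply/subsetP=> i.
by rewrite !inE mxE; case: (d 0 i == 0); rewrite ?eqxx.
Qed.

(** Its row space is spanned by the basis vectors indexed by [A]. It serves both as a subspace, in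
    [stablemx], and as a cut-off to the rows or columns in [A]. *)
Definition coord_proj (F : fieldType) n (A : {set 'I_n}) : 'M[F]_n :=
  diag_mx (\row_k (k \in A)%:R).

Lemma tr_coord_proj (F : fieldType) n (A : {set 'I_n}) :
  (coord_proj F A)^T = coord_proj F A.
Proof. exact: tr_diag_mx. Qed.

Lemma stable_coord_proj (F : fieldType) n (A : {set 'I_n}) (M : 'M[F]_n) :
  (forall i j, i \in A -> j \notin A -> M i j = 0) ->
  stablemx (coord_proj F A) M.
Proof.
move=> h; apply/submxP; exists (coord_proj F A *m M).
rewrite /coord_proj mul_mx_diag mul_diag_mx; apply/matrixP=> i j; rewrite !mxE.
have [iA|] := boolP (i \in A); last by rewrite !mul0r.
by have [|jA] := boolP (j \in A); rewrite ?mulr1 // h // !mulr0.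
Qed.

(** An invertible [f] preserves rank, so the inclusion of [V *m f] in [V] is an equality of row
    spaces. *)
Lemma stablemx_invmx (F : fieldType) m n (V : 'M[F]_(m, n)) (f : 'M_n) :
  f \in unitmx -> stablemx V f -> stablemx V (invmx f).
Proof.
move=> fu Vf.
have : (V <= V *m f)%MS.
  by have [_ <-] := mxrank_leqif_sup Vf; rewrite mxrankMfree // row_free_unit.
by case/submxP=> X e; rewrite {1}e mulmxA mulmxK // submxMl.
Qed.

Lemma coupleE (F : fieldType) n (Y : 'M[F]_n) f (s : 'S_n) i j :
  couple Y f s -> Y i j = (i == s j)%:R * f j.
Proof.
move=> /(_ j) /(congr1 (fun M : 'cV_n => M i 0)).
by rewrite -colE !mxE eqxx andbT mulrC.
Qed.

Lemma couple_neq0 (F : fieldType) n (Y : 'M[F]_n) f (s : 'S_n) i j :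
  couple Y f s -> (Y i j != 0) = (i == s j) && (f j != 0).
Proof. by move=> /coupleE->; case: (i == s j); rewrite ?mul1r // mul0r eqxx. Qed.

(** Permuting the rows by [s] makes the cut-off matrix diagonal, and its rank is the number of
    nonzero diagonal entries. The sets trade places because a couple sends a column index to a row
    index. *)
Lemma couple_rank (F : fieldType) n (Y : 'M[F]_n) f (s : 'S_n) (A B : {set 'I_n}) :
  couple Y f s ->
  \rank (coord_proj F A *m Y *m coord_proj F B) = couple_count f s B A.
Proof.
have rankE (M : 'M[F]_n) : \rank M = \rank (perm_mx s *m M).
  rewrite -[LHS]mxrank_tr -[RHS]mxrank_tr trmx_mul mxrankMfree //.
  by rewrite row_free_unit unitmx_tr unitmx_perm.
move=> hY; rewrite rankE; set M := _ *m coord_proj F B.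
have -> : perm_mx s *m M = diag_mx (\row_k (f k *+ ((k \in B) && (s k \in A)))).
  rewrite -row_permE /M mul_mx_diag mul_diag_mx.
  apply/matrixP=> i j; rewrite !mxE (coupleE _ _ hY) (inj_eq perm_inj).
  have [->|_] := eqVneq i j; last by rewrite !(mul0r, mulr0).
  by case: (j \in B); case: (s j \in A); rewrite !(mul0r, mulr0, mul1r, mulr1).
rewrite rank_diag_mx; apply: eq_card => k; rewrite !inE mxE.
by case: (_ && _); rewrite ?andbT ?andbF // eqxx.
Qed.

Lemma alternating_couple (F : fieldType) n (Y : 'M[F]_n) f (s : 'S_n) :
  alternating Y -> couple Y f s -> (s * s = 1)%g ->
  fixfree_involution_on [set k | f k != 0] s.
Proof.
move=> [altY Y0] hY ss k; rewrite !inE => fk.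
have sk : s (s k) = k by rewrite -permM ss perm1.
have nz : Y (s k) k != 0 by rewrite (couple_neq0 _ _ hY) eqxx.
split=> //; last by apply: contra_neq nz => {1}->; exact: Y0.
have := couple_neq0 k (s k) hY; rewrite sk eqxx /= => <-.
move: nz; have := congr1 (fun M : 'M_n => M k (s k)) altY; rewrite !mxE => ->.
by rewrite oppr_eq0.
Qed.

(** * Flags stabilized by a parabolic subgroup *)

(* The initial segments of {1,...,n} that are unions of diagonal blocks of P. *)
Definition flag_set n (W : {group 'S_n}) (A : {set 'I_n}) : Prop :=
  [acts W, on A | 'P] /\ forall i j : 'I_n, (i <= j)%N -> j \in A -> i \in A.

(** The invertible matrices whose transpose stabilizes the flag subspace form a subgroup, so only
    the generators need checking. Triangular ones work because [A] is an initial segment,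
    permutation matrices because [W] acts on [A]. *)
Lemma flag_generated n (W : {group 'S_n}) (F : fieldType) (P : 'M[F]_n -> Prop) A g :
  weyl_group_of P W -> flag_set W A -> P g ->
  g \in unitmx /\ stablemx (coord_proj F A) g^T.
Proof.
case=> J [_ PJ WJ] [WA iA] /PJ.
move=> /(_ (fun g => g \in unitmx /\ stablemx (coord_proj F A) g^T)).
apply.
  split=> [h [] //||h k [hu hA] [ku kA]|h [hu hA]].
  - by rewrite unitmx1 trmx1 mulmx1.
  - by rewrite unitmx_mul hu ku trmx_mul; split=> //; apply: stablemxM.
  - by rewrite unitmx_inv trmx_inv; split=> //; apply: stablemx_invmx; rewrite ?unitmx_tr.
move=> x [[xu xt]|[s sJ ->]].
  split=> //; apply: stable_coord_proj => i j iAi jA.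
  apply: (is_trig_mxP xt); rewrite ltnNge; apply: contra jA => ji.
  exact: iA ji iAi.
rewrite unitmx_perm tr_perm_mx; split=> //; apply: stable_coord_proj => i j iAi jA.
rewrite !mxE; case: eqP => // e; case/negP: jA; rewrite -e.
have sW : (s^-1)%g \in W by rewrite groupV WJ mem_gen.
by rewrite -[_ i]/('P%act i s^-1%g) (acts_act WA).
Qed.

(** Flag stability moves the factors [p^T] and [q] outside the two cut-offs, so the rank of the
    cut-off block cannot grow under P-equivalence. Applying this in both directions gives
    equality. *)
Lemma couple_count_equivalent (F : fieldType) n (W : {group 'S_n}) P
    (Y Z : 'M[F]_n) f s g t A B :
  weyl_group_of P W -> GL_subgroup P -> flag_set W A -> flag_set W B ->
  equivalent_under P Y Z -> couple Y f s -> couple Z g t ->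
  couple_count f s B A = couple_count g t B A.
Proof.
move=> hW [Pu P1 PM PV] hA hB YZ hY hZ.
rewrite -(couple_rank A B hY) -(couple_rank A B hZ).
have le X X' : equivalent_under P X X' ->
    (\rank (coord_proj F A *m X' *m coord_proj F B) <=
     \rank (coord_proj F A *m X *m coord_proj F B))%N.
  case=> p [q [Pp Pq ->]].
  have [_ /submxP[U eU]] := flag_generated hW hA Pp.
  have [_ /submxP[V eV]] := flag_generated hW hB Pq.
  have {}eV : q *m coord_proj F B = coord_proj F B *m V^T.
    by apply: trmx_inj; rewrite !trmx_mul tr_coord_proj trmxK.
  rewrite !mulmxA eU -!mulmxA eV !mulmxA -!mulmxA.
  by rewrite (leq_trans (mxrankM_maxr _ _)) // !mulmxA mxrankM_maxl.
apply/eqP; rewrite eqn_leq !le //.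
case: YZ => p [q [Pp Pq ->]]; exists (invmx p), (invmx q); split; try exact: PV.
by rewrite trmx_inv !mulmxA mulVmx ?unitmx_tr ?mul1mx ?mulmxK //; exact: Pu.
Qed.

Lemma orbit_interval n (W : {group 'S_n}) (J : {set 'S_n}) (x y z : 'I_n) :
  (forall s, s \in J -> adjacent_transposition s) -> W :=: <<J>>%g ->
  (x <= y <= z)%N -> z \in orbit 'P W x -> y \in orbit 'P W x.
Proof.
move=> Jt WJ /andP[xy yz] zx; apply/negPn/negP => yx.
(* If y were missing, the part of the orbit below y would be invariant: an
   adjacent transposition cannot jump over y. *)
pose A := [set t in orbit 'P W x | (t <= y)%N].
have stepA s t : s \in J -> t \in A -> s t \in A.
  move=> sJ; rewrite !inE => /andP[tx ty].
  have sW : s \in W by rewrite WJ mem_gen.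
  have stx : s t \in orbit 'P W x.
    by rewrite -[s t]/('P%act t s) orbit_actr.
  have [i [j [ji es]]] := Jt s sJ.
  rewrite stx /= leqNgt; apply/negP => yst.
  have : t = y :> nat.
    apply/eqP; rewrite eqn_leq ty /= -ltnS (leq_trans yst) // es.
    case: tpermP => [->|->|_ _]; rewrite ?ji //.
    exact: ltnW.
  by move=> /val_inj e; rewrite -e tx in yx.
have WA : [acts W, on A | 'P].
  rewrite WJ gen_subG; apply/subsetP=> s sJ.
  rewrite !inE; apply/subsetP=> t tA; rewrite inE; exact: stepA.
have /subsetP/(_ z zx) : orbit 'P W x \subset A.
  by rewrite (acts_sub_orbit _ WA) inE orbit_refl.
rewrite inE => /andP[_ zy].
have e : y = z by apply: val_inj; apply/eqP; rewrite eqn_leq yz.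
by rewrite e zx in yx.
Qed.

(** This presents an orbit as a difference of two flag sets. [A] consists of the points lying below
    some point of the orbit; since orbits are intervals, deleting the orbit from [A] leaves an
    initial segment. *)
Lemma flag_of_orbit n (W : {group 'S_n}) (J : {set 'S_n}) (x : 'I_n) :
  (forall s, s \in J -> adjacent_transposition s) -> W :=: <<J>>%g ->
  exists A, [/\ flag_set W A, flag_set W (A :\: orbit 'P W x)
              & orbit 'P W x \subset A].
Proof.
move=> Jt WJ; pose A := [set t : 'I_n | [exists z in orbit 'P W x, (t <= z)%N]].
have inA (t : 'I_n) : reflect (exists2 z, z \in orbit 'P W x & (t <= z)%N) (t \in A).
  by rewrite inE; apply: exists_inP.
have xA : orbit 'P W x \subset A by apply/subsetP=> z zx; apply/inA; exists z.
have lowA (i j : 'I_n) : (i <= j)%N -> j \in A -> i \in A.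
  by move=> ij /inA[z zx jz]; apply/inA; exists z => //; apply: leq_trans jz.
have WA : [acts W, on A | 'P].
  apply/subsetP=> s sW; rewrite !inE; apply/subsetP=> t /inA[z zx tz].
  rewrite inE; have [stz|zst] := leqP (s t) z; first by apply/inA; exists z.
  (* If [s] carries [t] past [z], then [z] lies between two points of the orbit of [t], so the
     orbits of [t] and [x] coincide. *)
  have tst : s t \in orbit 'P W t by apply/orbitP; exists s.
  apply: (subsetP xA).
  have zt : z \in orbit 'P W t.
    by apply: orbit_interval Jt WJ _ tst; rewrite tz ltnW.
  have /orbit_eqP ezt := zt; have /orbit_eqP ezx := zx.
  by rewrite -ezx ezt.
exists A; split=> //; split=> //.
  apply: subset_trans (astabsD _ _ _); rewrite subsetI WA.
  exact: acts_orbit (subsetT _).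
move=> i j ij /setDP[jA jx]; apply/setDP; split; first exact: lowA jA.
apply: contra jx => ix; have /inA[z zx jz] := jA.
have /orbit_eqP eix := ix; rewrite -eix.
by apply: orbit_interval Jt WJ _ (_ : z \in _); rewrite ?ij ?eix.
Qed.

(** * Counts between orbits and the reduced permutation *)

Lemma couple_count_orbit (F : fieldType) n (W : {group 'S_n}) (f : 'I_n -> F)
    (s : 'S_n) x y :
  couple_count f s (orbit 'P W x) (orbit 'P W y) =
  color_count (orbit 'P W) [set k | f k != 0] s (orbit 'P W x) (orbit 'P W y).
Proof. by apply: eq_card => k; rewrite !inE !orbit_eq_mem. Qed.

Lemma couple_countDl (F : fieldType) n (f : 'I_n -> F) (s : 'S_n)
    (A o B : {set 'I_n}) :
  o \subset A ->
  couple_count f s A B = (couple_count f s o B + couple_count f s (A :\: o) B)%N.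
Proof.
move=> /subsetP oA; rewrite /couple_count -(cardsID o).
congr (_ + _)%N; apply: eq_card => k; rewrite !inE; last first.
  by case: (k \in o) (k \in A) (f k == 0) => [] [] [].
by have := oA k; case: (k \in o) => [->|_] //; rewrite ?andbT ?andbF.
Qed.

Lemma couple_countDr (F : fieldType) n (f : 'I_n -> F) (s : 'S_n)
    (A B o : {set 'I_n}) :
  o \subset B ->
  couple_count f s A B = (couple_count f s A o + couple_count f s A (B :\: o))%N.
Proof.
move=> /subsetP oB; rewrite /couple_count -(cardsID (s @^-1: o)).
congr (_ + _)%N; apply: eq_card => k; rewrite !inE; last first.
  by case: (k \in A) (s k \in o) (s k \in B) (f k == 0) => [] [] [] [].
by have := oB (s k); case: (s k \in o) => [->|_] //; rewrite ?andbT ?andbF.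
Qed.

(** Counts are additive in each argument, and each orbit is a difference of flag sets, so the
    invariance of flag counts passes to orbits one argument at a time. *)
Lemma couple_count_orbit_equivalent (F : fieldType) n (W : {group 'S_n}) P
    (Y Z : 'M[F]_n) f s g t x y :
  weyl_group_of P W -> GL_subgroup P -> equivalent_under P Y Z ->
  couple Y f s -> couple Z g t ->
  couple_count f s (orbit 'P W x) (orbit 'P W y) =
  couple_count g t (orbit 'P W x) (orbit 'P W y).
Proof.
move=> hW hP YZ hY hZ.
have [J [Jt _ WJ]] := hW.
have [A [hA hA' oA]] := flag_of_orbit x Jt WJ.
have [B [hB hB' oB]] := flag_of_orbit y Jt WJ.
have eqAB A0 B0 : flag_set W A0 -> flag_set W B0 ->
    couple_count f s A0 B0 = couple_count g t A0 B0.
  by move=> h1 h2; apply: couple_count_equivalent hW hP h2 h1 YZ hY hZ.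
have eqoB B0 : flag_set W B0 ->
    couple_count f s (orbit 'P W x) B0 = couple_count g t (orbit 'P W x) B0.
  move=> hB0; have := eqAB _ _ hA hB0.
  by rewrite !(couple_countDl _ _ _ oA) (eqAB _ _ hA' hB0) => /addIn.
have := eqoB _ hB; rewrite !(couple_countDr _ _ _ oB) (eqoB _ hB').
exact: addIn.
Qed.

Lemma reduced_permE (F : fieldType) n (W : {group 'S_n}) (Y : 'M[F]_n) f
    (s : 'S_n) k :
  alternating Y -> couple Y f s -> (s * s = 1)%g ->
  reduced_perm W f s k =
  if (f k != 0) && (s k \notin orbit 'P W k) then s k else k.
Proof.
move=> altY hY ss; have inv := alternating_couple altY hY ss.
have sK : involutive s by move=> i; rewrite -permM ss perm1.
rewrite /reduced_perm (prod_tperm_involution (s := s)) //; last first.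
  by move=> i /and3P[lt_i _ _]; rewrite sK ltnNge (ltnW lt_i).
rewrite sK orbit_sym; have [fk0|fk] := eqVneq (f k) 0; rewrite /= ?andbF /=.
  have [fsk0|fsk] := eqVneq (f (s k)) 0; first by rewrite /= andbF.
  by have [|] := inv (s k); rewrite inE // sK fk0 eqxx.
have [|fsk _ sk] := inv k; first by rewrite inE.
rewrite inE in fsk; rewrite fsk /= -andb_orl.
have -> // : (k < s k)%N || (s k < k)%N; by rewrite -neq_ltn eq_sym.
Qed.

(** A point of the first orbit that the reduced permutation fixes stays outside the second orbit. It
    is not counted on the left either: [f] vanishes there or [s] keeps it in its own orbit. *)
Lemma couple_count_reduced (F : fieldType) n (W : {group 'S_n}) (Y : 'M[F]_n) f
    (s : 'S_n) x y :
  alternating Y -> couple Y f s -> (s * s = 1)%g ->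
  orbit 'P W x != orbit 'P W y ->
  couple_count f s (orbit 'P W x) (orbit 'P W y) =
  #|[set k in orbit 'P W x | reduced_perm W f s k \in orbit 'P W y]|.
Proof.
move=> altY hY ss nxy; apply: eq_card => k; rewrite !inE (reduced_permE _ _ altY hY ss).
rewrite andbCA; have [/orbit_eqP kx|//] := boolP (k \in orbit 'P W x); rewrite /=.
have ky : k \in orbit 'P W y = false.
  by apply: contraNF nxy => /orbit_eqP <-; rewrite kx.
have [_|fk] /= := eqVneq (f k) 0; first by rewrite ky.
case: ifP => //= /negbFE /orbit_eqP e; rewrite ky.
by apply: contraFF ky => /orbit_eqP; rewrite e -orbit_eq_mem => ->.
Qed.

(** * From block counts to congruence *)

(** The colour of a point is its orbit. A colour-preserving permutation preserves each orbit and
    therefore lies in [W]. *)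
Lemma couple_counts_conjugate (F : fieldType) n (W : {group 'S_n})
    (P : 'M[F]_n -> Prop) (Y Z : 'M[F]_n) f s g t :
  weyl_group_of P W -> alternating Y -> alternating Z ->
  couple Y f s -> couple Z g t -> (s * s = 1)%g -> (t * t = 1)%g ->
  (forall x y, couple_count f s (orbit 'P W x) (orbit 'P W y) =
               couple_count g t (orbit 'P W x) (orbit 'P W y)) ->
  exists2 w, w \in W & forall k, (g (w k) != 0) = (f k != 0) /\
    (f k != 0 -> w (s k) = t (w k)).
Proof.
move=> [J [Jt _ WJ]] altY altZ hY hZ ss tt eqc.
have [||a b|w [cw Sw sw]] :=
  @matching_conjugate _ _ (orbit 'P W) [set k | f k != 0] [set k | g k != 0] s t.
- exact: alternating_couple altY hY ss.
- exact: alternating_couple altZ hZ tt.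
(* Colours range over all sets of indices; when [a] or [b] is not an orbit, both counts are zero. *)
- have [/existsP[x /existsP[y /andP[/eqP<- /eqP<-]]]|nab] :=
    boolP [exists x, exists y, (orbit 'P W x == a) && (orbit 'P W y == b)].
    by rewrite -!couple_count_orbit eqc.
  have c0 (S : {set 'I_n}) (u : 'S_n) : color_count (orbit 'P W) S u a b = 0%N.
    apply/eqP; rewrite cards_eq0; apply/eqP/setP=> k; rewrite !inE.
    apply: contraNF nab => /andP[_ ab]; apply/existsP; exists k.
    by apply/existsP; exists (u k).
  by rewrite !c0.
exists w.
  apply: (perm_stabilizing_orbits _ cw); exists J; split=> // v /Jt[i [j [_ ->]]].
  by exists i, j.
by move=> k; split=> [|fk]; [have := Sw k; rewrite !inE | apply: sw; rewrite inE].
Qed.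

Lemma perm_mx_weyl (F : fieldType) n (W : {group 'S_n}) (P : 'M[F]_n -> Prop) w :
  weyl_group_of P W -> GL_subgroup P -> w \in W -> P (perm_mx w).
Proof.
move=> [J [_ PJ WJ]] [_ P1 PM _]; have -> : (w \in W) = (w \in <<J>>%g) by rewrite -WJ.
case/gen_prodgP=> m [e eJ ->]; elim: m e eJ => [|m IHm] e eJ.
  by rewrite big_ord0 perm_mx1.
rewrite big_ord_recr perm_mxM; apply: PM; first exact: IHm.
by apply/PJ=> H _; apply; right; exists (e ord_max).
Qed.

(** The nonzero entries come in pairs at positions [(i, t i)] and [(t i, i)]. Rescaling only the
    smaller index of each pair corrects the entry above the diagonal without square roots, and
    skew-symmetry corrects the other one. *)
Lemma alternating_diag_congruent (F : fieldType) n (X Z : 'M[F]_n) g t :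
  alternating X -> alternating Z -> couple Z g t -> (t * t = 1)%g ->
  (forall i j, (X i j != 0) = (Z i j != 0)) ->
  exists2 h, borel h & h^T *m X *m h = Z.
Proof.
move=> [altX X0] [altZ Z0] hZ tt XZ.
pose d := \row_i (if (i < t i)%N && (g i != 0) then Z i (t i) / X i (t i) else 1).
have tK : involutive t by move=> i; rewrite -permM tt perm1.
exists (diag_mx d).
  split; last by rewrite tr_diag_mx diag_mx_is_trig.
  rewrite unitmxE unitfE det_diag; apply/prodf_neq0 => i _; rewrite mxE.
  case: ifP => [/andP[_ gi]|_]; last exact: oner_neq0.
  have Zi : Z i (t i) != 0.
    have [|gti _ _] := alternating_couple (conj altZ Z0) hZ tt (x := i).
      by rewrite inE.
    by rewrite inE in gti; rewrite (couple_neq0 _ _ hZ) tK eqxx.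
  by rewrite mulf_neq0 ?invr_eq0 ?XZ.
have trX i j : X j i = - X i j.
  by have := congr1 (fun M : 'M_n => M i j) altX; rewrite !mxE.
have trZ i j : Z j i = - Z i j.
  by have := congr1 (fun M : 'M_n => M i j) altZ; rewrite !mxE.
rewrite tr_diag_mx mul_mx_diag mul_diag_mx; apply/matrixP=> i j.
rewrite 2![in LHS]mxE; have [Zij|Zij] := eqVneq (Z i j) 0.
  have /eqP-> : X i j == 0 by rewrite -[_ == _]negbK XZ Zij eqxx.
  by rewrite Zij mulr0 mul0r.
have Xij : X i j != 0 by rewrite XZ.
have /andP[/eqP ij gj] : (i == t j) && (g j != 0) by rewrite -(couple_neq0 _ _ hZ).
have /andP[/eqP ji gi] : (j == t i) && (g i != 0).
  by rewrite -(couple_neq0 _ _ hZ) trZ oppr_eq0.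
rewrite !mxE -ij -ji gi gj !andbT; case: ltngtP => [lt_ij|lt_ji|/val_inj e].
- by rewrite mulr1 divfK.
- by rewrite mul1r trX trZ invrN mulrNN mulrC divfK.
- by rewrite e Z0 eqxx in Zij.
Qed.

(** Congruence by the permutation matrix of [w] moves the support of [Y] onto that of [Z]; the
    values, signs included, are then adjusted by an element of the Borel subgroup. *)
Lemma weyl_conjugate_congruent (F : fieldType) n (W : {group 'S_n})
    (P : 'M[F]_n -> Prop) (Y Z : 'M[F]_n) f s g t w :
  weyl_group_of P W -> standard_parabolic P -> alternating Y -> alternating Z ->
  couple Y f s -> couple Z g t -> (t * t = 1)%g -> w \in W ->
  (forall k, (g (w k) != 0) = (f k != 0) /\ (f k != 0 -> w (s k) = t (w k))) ->
  congruent_under P Y Z.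
Proof.
move=> hW [hP PB] altY altZ hY hZ tt wW hw; have [Pu P1 PM PV] := hP.
pose X := (perm_mx w)^T *m Y *m perm_mx w.
have XE i j : X i j = Y (w^-1%g i) (w^-1%g j).
  by rewrite /X tr_perm_mx -row_permE -[w in perm_mx w]invgK -col_permE !mxE.
have [|i j|h Bh <-] := alternating_diag_congruent (X := X) _ altZ hZ tt.
- case: altY => altY Y0; split=> [|i]; last by rewrite XE.
  by rewrite /X !trmx_mul trmxK altY mulNmx mulmxN mulmxA.
- rewrite XE (couple_neq0 _ _ hY) (couple_neq0 _ _ hZ).
  have [e1 e2] := hw (w^-1%g j); rewrite permKV in e1 e2; rewrite e1.
  have [_|fj] := eqVneq (f _) 0; first by rewrite !andbF.
  by rewrite -e2 // -(inj_eq (@perm_inj _ w)) permKV.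
exists (perm_mx w *m h); split.
  by apply: PM; [exact: perm_mx_weyl hW hP wW | exact: PB].
by rewrite trmx_mul !mulmxA.
Qed.

Lemma weyl_conjugate_reduced (F : fieldType) n (W : {group 'S_n})
    (Y Z : 'M[F]_n) f s g t w :
  alternating Y -> alternating Z ->
  couple Y f s -> couple Z g t -> (s * s = 1)%g -> (t * t = 1)%g -> w \in W ->
  (forall k, (g (w k) != 0) = (f k != 0) /\ (f k != 0 -> w (s k) = t (w k))) ->
  (reduced_perm W f s ^ w)%g = reduced_perm W g t.
Proof.
move=> altY altZ hY hZ ss tt wW hw; apply/permP=> j.
rewrite -[j](permKV w); set k := (w^-1)%g j; rewrite permJ.
rewrite (reduced_permE _ _ altY hY ss) (reduced_permE _ _ altZ hZ tt).
have [-> e] := hw k; have [_|fk] //= := eqVneq (f k) 0.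
have ow x : orbit 'P W (w x) = orbit 'P W x := orbit_act 'P x wW.
by rewrite -e // -!orbit_eq_mem !ow; case: ifP.
Qed.

(** * Formal properties of congruence and equivalence, and the theorem *)

Lemma congruent_under_sym (F : fieldType) n (P : 'M[F]_n -> Prop) X Y :
  GL_subgroup P -> congruent_under P X Y -> congruent_under P Y X.
Proof.
move=> [Pu _ _ PV] [h [Ph <-]]; exists (invmx h); split; first exact: PV.
by rewrite trmx_inv !mulmxA mulVmx ?unitmx_tr ?mul1mx ?mulmxK //; exact: Pu.
Qed.

Lemma congruent_under_trans (F : fieldType) n (P : 'M[F]_n -> Prop) X Y Z :
  GL_subgroup P ->
  congruent_under P X Y -> congruent_under P Y Z -> congruent_under P X Z.
Proof.
move=> [_ _ PM _] [h [Ph <-]] [k [Pk <-]]; exists (h *m k); split; first exact: PM.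
by rewrite trmx_mul !mulmxA.
Qed.

Lemma equivalent_under_trans (F : fieldType) n (P : 'M[F]_n -> Prop) X Y Z :
  GL_subgroup P ->
  equivalent_under P X Y -> equivalent_under P Y Z -> equivalent_under P X Z.
Proof.
move=> [_ _ PM _] [h [k [Ph Pk ->]]] [h' [k' [Ph' Pk' ->]]].
exists (h *m h'), (k *m k'); split; try exact: PM.
by rewrite trmx_mul !mulmxA.
Qed.

Lemma congruent_equivalent (F : fieldType) n (P : 'M[F]_n -> Prop) X Y :
  congruent_under P X Y -> equivalent_under P X Y.
Proof. by move=> [h [Ph <-]]; exists h, h. Qed.

Theorem theorem5p3 (F : fieldType) (n : nat) (hn : (2 <= n)%N)
    (P : 'M[F]_n -> Prop) (hP : standard_parabolic P)
    (W : {group 'S_n}) (hW : weyl_group_of P W)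
    (r : nat) (O : 'I_r -> {set 'I_n}) (O_inj : injective O)
    (O_orbits : [set O i | i : 'I_r] = [set orbit 'P W x | x : 'I_n])
    (C D : 'M[F]_n) (hC : alternating C) (hD : alternating D)
    (Y Z : 'M[F]_n)
    (hY : one_minus_one_matrix Y) (hZ : one_minus_one_matrix Z)
    (hYC : congruent_under (@borel F n) Y C)
    (hZD : congruent_under (@borel F n) Z D)
    (f : 'I_n -> F) (sigma : 'S_n)
    (hf : couple Y f sigma) (hsigma : (sigma * sigma = 1)%g)
    (g : 'I_n -> F) (tau : 'S_n)
    (hg : couple Z g tau) (htau : (tau * tau = 1)%g) :
  [<-> conjugate_under W (reduced_perm W f sigma) (reduced_perm W g tau) /\
         (forall i : 'I_r, couple_count f sigma (O i) (O i) =
                           couple_count g tau (O i) (O i));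
       congruent_under P C D;
       equivalent_under P C D].
Proof.
have [hP1 PB] := hP; have [[_ altY _] [_ altZ _]] := (hY, hZ).
have PYC : congruent_under P Y C.
  by case: hYC => b [/PB Pb e]; exists b.
have PZD : congruent_under P Z D.
  by case: hZD => b [/PB Pb e]; exists b.
have O_orbit x : exists i, O i = orbit 'P W x.
  have : orbit 'P W x \in [set O i | i : 'I_r] by rewrite O_orbits imset_f.
  by case/imsetP=> i _ ->; exists i.
tfae.
- case=> -[w wW ew] eqd.
  (* The given [w] conjugates only the reduced permutations and may disagree with the pairs inside
     orbits. It is used only to compare the counts between distinct orbits; the full set of counts
     then yields a new element [v] of [W] matching all pairs. *)
  have [x y|v vW hv] := couple_counts_conjugate hW altY altZ hf hg hsigma htau.
    have [exy|nxy] := eqVneq (orbit 'P W x) (orbit 'P W y).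
      by have [i Oi] := O_orbit y; rewrite exy -Oi eqd.
    rewrite (couple_count_reduced altY) // (couple_count_reduced altZ) //.
    rewrite -(card_imset _ (@perm_inj _ w)); apply: eq_card => k.
    rewrite -[k](permKV w) mem_imset; last exact: perm_inj.
    rewrite !inE -ew permJ -![w _]/('P%act _ w).
    by rewrite !orbit_actr.
  apply: (congruent_under_trans hP1 (congruent_under_sym hP1 PYC) _).
  apply: (congruent_under_trans hP1 _ PZD).
  exact: weyl_conjugate_congruent hW hP altY altZ hf hg htau vW hv.
- exact: congruent_equivalent.
- move=> CD; have YZ : equivalent_under P Y Z.
    apply: (equivalent_under_trans hP1 (congruent_equivalent PYC) _).
    apply: (equivalent_under_trans hP1 CD _).
    exact/congruent_equivalent/congruent_under_sym.
  (* All the counts agree, so a single [w] matches all pairs of [Y] and [Z], in particular those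
     that survive in the reduced permutations. *)
  have eqc x y := couple_count_orbit_equivalent x y hW hP1 YZ hf hg.
  have [w wW hw] := couple_counts_conjugate hW altY altZ hf hg hsigma htau eqc.
  split; first exists w => //.
    exact: weyl_conjugate_reduced altY altZ hf hg hsigma htau wW hw.
  move=> i; have : O i \in [set orbit 'P W x | x : 'I_n] by rewrite -O_orbits imset_f.
  by case/imsetP=> x _ ->.
Qed.
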